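(* Let $n\ge1$ and let $U\in\mathcal{C}_2^{(n)}$ be a Clifford unitary such that for some integer $t\ge 0$, $U^{2^t}$ is a scalar multiple of an element of $\mathcal{P}_n$. Then the projective Pauli periodicity $m$ of $U$ satisfies $$m\le\lceil\log_2(2n)\rceil.$$ Moreover, this bound is tight: for every $n>1$ there exists a Clifford unitary $U\in\mathcal{C}_2^{(n)}$ whose projective Pauli periodicity is exactly $\lceil\log_2(2n)\rceil$; multiplying it by a suitable global phase, one may moreover take $U^{2^{\lceil\log_2(2n)\rceil}}\in\mathcal{P}_n$, so that its Pauli periodicity is also exactly $\lceil\log_2(2n)\rceil$.
   Context: The $n$-qubit Pauli group is $\mathcal{P}_n=\{\omega P_1\otimes\cdots\otimes P_n:\ \omega\in\{\pm1,\pm \mathrm{i}\},\ P_j\in\{I,X,Y,Z\}\}$. The Clifford group is $\mathcal{C}_2^{(n)}=\{U\in U(2^n):\ UPU^\dagger\in\mathcal{P}_n\ \forall P\in\mathcal{P}_n\}$. The Pauli periodicity of $U$ is $\min\{t\ge 0:\ U^{2^t}\in\mathcal{P}_n\}$ (exact membership). The projective Pauli periodicity of $U$ is $\min\{t\ge0:\ U^{2^t}=cP\text{ for some }c\in\mathbb{C},|c|=1,P\in\mathcal{P}_n\}$. *)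

(* Defs.v *)
(* Complex scalars: an arbitrary numClosedFieldType C
   (e.g. the complex numbers R[i]). *)
From mathcomp Require Import all_boot all_order all_algebra.
Set Implicit Arguments. Unset Strict Implicit. Unset Printing Implicit Defensive.
Import Order.TTheory GRing.Theory Num.Theory.
Local Open Scope ring_scope.

Section Pauli.
Variable C : numClosedFieldType.

(* bit k of the natural number i *)
Definition bit (i k : nat) : bool := odd (i %/ 2 ^ k).

(* single-qubit Paulis: 0 = I, 1 = X, 2 = Y, 3 = Z; entry (b, c) *)
Definition sigma (a : 'I_4) (b c : bool) : C :=
  match val a with
  | 0%N => if b == c then 1 else 0
  | 1%N => if b == c then 0 else 1
  | 2%N => if b == c then 0 else if b then 'i else - 'i
  | _   => if b == c then (if b then -1 else 1) else 0
  end.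

(* tensor product P_{p 0} (x) ... (x) P_{p (n-1)}, written entrywise:
   qubit k is encoded by bit k of the row/column index *)
Definition pauli_string (n : nat) (p : {ffun 'I_n -> 'I_4}) : 'M[C]_(2 ^ n) :=
  \matrix_(i, j) \prod_(k < n) sigma (p k) (bit i k) (bit j k).

(* the n-qubit Pauli group: omega * P_1 (x) ... (x) P_n, omega in {1,i,-1,-i} *)
Definition isPauli (n : nat) (M : 'M[C]_(2 ^ n)) : Prop :=
  exists (w : 'I_4) (p : {ffun 'I_n -> 'I_4}), M = ('i ^+ w) *: pauli_string p.

(* conjugate transpose *)
Definition adj (m : nat) (U : 'M[C]_m) : 'M[C]_m := (map_mx (fun x => x^*) U)^T.

Definition unitary (m : nat) (U : 'M[C]_m) : Prop := U *m adj U = 1%:M.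

Definition clifford (n : nat) (U : 'M[C]_(2 ^ n)) : Prop :=
  unitary U /\ forall P, isPauli P -> isPauli (U *m P *m adj U).

(* matrix power U^k *)
Definition mxpow (m : nat) (U : 'M[C]_m) (k : nat) : 'M[C]_m :=
  iter k (mulmx U) 1%:M.

(* c P with |c| = 1 and P a Pauli *)
Definition projPauli (n : nat) (M : 'M[C]_(2 ^ n)) : Prop :=
  exists (c : C) (P : 'M[C]_(2 ^ n)), `|c| = 1 /\ isPauli P /\ M = c *: P.

(* m = min { t | U^(2^t) in P_n } *)
Definition pauli_periodicity (n : nat) (U : 'M[C]_(2 ^ n)) (m : nat) : Prop :=
  isPauli (mxpow U (2 ^ m)) /\ forall t, (t < m)%N -> ~ isPauli (mxpow U (2 ^ t)).

(* m = min { t | U^(2^t) = c P, |c| = 1, P in P_n } *)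
Definition proj_pauli_periodicity (n : nat) (U : 'M[C]_(2 ^ n)) (m : nat) : Prop :=
  projPauli (mxpow U (2 ^ m)) /\ forall t, (t < m)%N -> ~ projPauli (mxpow U (2 ^ t)).

End Pauli.

(* Main.v *)
Require Import Defs.
From mathcomp Require Import all_boot all_order all_algebra zify.
Set Implicit Arguments. Unset Strict Implicit. Unset Printing Implicit Defensive.
Import Order.TTheory GRing.Theory Num.Theory.
Local Open Scope ring_scope.

(** A Clifford unitary U acts by conjugation on the Pauli group modulo phases,
    i.e. linearly on F_2^(2n), through a matrix S; and U is proportional to a Pauli
    iff S = 1. If S^(2^t) = 1 then (S - 1)^(2^t) = 0 in characteristic 2, so S - 1 is
    nilpotent, (S - 1)^(2n) = 0, and S^(2^m) = 1 as soon as 2^m >= 2n.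

    For tightness take U|x> = i^(x_0) |xG>, a phase gate on one qubit followed by the
    linear reversible circuit of a unipotent Jordan block G. With 2^s the least power
    of 2 that is at least n, G^(2^s) = 1, hence U^(2^s) is diagonal with entries
    i^Q(x), where Q(x) counts the j < 2^s with (x G^j)_0 = 1. As Q is additive mod 2,
    U^(2^(s+1)) is a string of Z's; as Q(x+y) - Q(x) - Q(y) = 2 mod 4 for some
    basis vectors x, y, U^(2^s) is not proportional to a Pauli. *)

(** * Linear algebra over the field with two elements *)

Lemma addvv (m n : nat) (A : 'M[bool]_(m, n)) : A + A = 0.
Proof. by apply/matrixP=> i j; rewrite !mxE; case: (A i j). Qed.

Lemma addvK (m n : nat) (A B : 'M[bool]_(m, n)) : A + B + B = A.
Proof. by rewrite -addrA addvv addr0. Qed.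

Lemma addv_can (m n : nat) (B : 'M[bool]_(m, n)) :
  cancel (fun A => A + B) (fun A => A + B).
Proof. by move=> A; rewrite addvK. Qed.

(** Frobenius: as 1 and [A] commute, the two cross terms of each square cancel in characteristic
    2. *)
Lemma exp2n_add1 (n t : nat) (A : 'M[bool]_n.+1) :
  (1 + A) ^+ (2 ^ t) = 1 + A ^+ (2 ^ t).
Proof.
elim: t => [|t IH]; first by rewrite !expr1.
by rewrite expnS mulnC !exprM IH expr2 mulrDl mul1r !mulrDr mulr1 -expr2 addrA addvK.
Qed.

(** The minimal polynomial divides X^k, hence is X^d up to a unit, and d is at most the dimension
    because it also divides the characteristic polynomial. *)
Lemma nilpotent_exp_dim (F : fieldType) (n k : nat) (A : 'M[F]_n.+1) :
  A ^+ k = 0 -> A ^+ n.+1 = 0.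
Proof.
move=> Ak; have: mxminpoly A %| ('X - 0%:P) ^+ k.
  by apply: mxminpoly_min; rewrite subr0 rmorphXn /= horner_mx_X.
case/dvdp_exp_XsubCP=> d _; rewrite subr0 => minA.
have le_dn: (d <= n.+1)%N.
  have := dvdp_leq _ (mxminpoly_dvd_char A).
  rewrite (eqp_size minA) size_polyXn size_char_poly ltnS; apply.
  by rewrite -size_poly_gt0 size_char_poly.
have Ad: A ^+ d = 0.
  have: horner_mx A 'X^d = 0.
    by apply/mxminpoly_minP; rewrite (eqp_dvdl _ minA) dvdpp.
  by rewrite rmorphXn /= horner_mx_X.
by have := exprD A (n.+1 - d) d; rewrite subnK // Ad mulr0.
Qed.

Lemma unipotent_exp2n (n t s : nat) (S : 'M[bool]_n.+1) :
  S ^+ (2 ^ t) = 1 -> (n.+1 <= 2 ^ s)%N -> S ^+ (2 ^ s) = 1.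
Proof.
move=> St le_ns; set A := S + 1.
have SE: S = 1 + A by rewrite addrC addvK.
have /eqP At: A ^+ (2 ^ t) == 0.
  by rewrite -(inj_eq (addrI 1)) -exp2n_add1 -SE St addr0.
rewrite SE exp2n_add1 -(subnK le_ns) exprD (nilpotent_exp_dim At) mulr0.
exact: addr0.
Qed.

Definition dot (n : nat) (a b : 'rV[bool]_n) : bool := (a *m b^T) 0 0.

Lemma dotDl n (a b c : 'rV[bool]_n) : dot (a + b) c = dot a c (+) dot b c.
Proof. by rewrite /dot mulmxDl mxE. Qed.

Lemma dotDr n (a b c : 'rV[bool]_n) : dot a (b + c) = dot a b (+) dot a c.
Proof. by rewrite /dot linearD mulmxDr mxE. Qed.

Lemma dot0l n (a : 'rV[bool]_n) : dot 0 a = false.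
Proof. by rewrite /dot mul0mx mxE. Qed.

Lemma dot0r n (a : 'rV[bool]_n) : dot a 0 = false.
Proof. by rewrite /dot trmx0 mulmx0 mxE. Qed.

Lemma dotMr n m (a : 'rV[bool]_m) (b : 'rV[bool]_n) (M : 'M_(n, m)) :
  dot a (b *m M) = dot (a *m M^T) b.
Proof. by rewrite /dot trmx_mul mulmxA. Qed.

Lemma dot_deltal n k (a : 'rV[bool]_n) : dot (delta_mx 0 k) a = a 0 k.
Proof. by rewrite /dot -rowE !mxE. Qed.

Lemma dot_deltar n k (a : 'rV[bool]_n) : dot a (delta_mx 0 k) = a 0 k.
Proof. by rewrite /dot trmx_delta -colE mxE. Qed.

Lemma dot_inj n (a b : 'rV[bool]_n) : dot a =1 dot b -> a = b.
Proof. by move=> ab; apply/rowP=> k; rewrite -!dot_deltar ab. Qed.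

Lemma dot_injr n (a b : 'rV[bool]_n) : (forall c, dot c a = dot c b) -> a = b.
Proof. by move=> ab; apply/rowP=> k; rewrite -!dot_deltal ab. Qed.

(** The only scalars are 0 and 1, so additivity already is linearity. *)
Lemma additive_mulmx n m (f : 'rV[bool]_n -> 'rV[bool]_m) :
  {morph f : x y / x + y} -> exists M, forall x, f x = x *m M.
Proof.
move=> fD.
have f0: f 0 = 0 by apply: (addIr (f 0)); rewrite -fD addr0 add0r.
exists (\matrix_i f (delta_mx 0 i)) => x.
rewrite {1}(row_sum_delta x) (big_morph f fD f0).
apply/rowP=> k; rewrite summxE mxE; apply: eq_bigr => i _; rewrite mxE.
by case: (x 0 i); rewrite ?scale1r ?scale0r ?f0 ?mxE ?mul1r ?mul0r.
Qed.

Lemma additive_dotE n (f : 'rV[bool]_n -> bool) :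
  (forall x y, f (x + y) = f x (+) f y) -> exists b, f =1 dot b.
Proof.
move=> fD; have [x y|M fM] := @additive_mulmx n 1 (fun x => (f x)%:M).
  by rewrite fD -raddfD.
exists M^T => x; have /matrixP/(_ 0 0) := fM x; rewrite mxE mulr1n => ->.
by rewrite /dot -trmx_mul [RHS]mxE.
Qed.

(** * Monomial matrices and Pauli operators *)

Section Monomial.
Variables (C : numClosedFieldType) (n : nat).
Notation V := 'rV[bool]_n.
Notation I2n := 'I_(2 ^ n).

Definition bits (i : I2n) : V := \row_k bit i k.

Lemma bit_inj m i j : (i < 2 ^ m)%N -> (j < 2 ^ m)%N ->
  (forall k, (k < m)%N -> bit i k = bit j k) -> i = j.
Proof.
elim: m i j => [|m IH] i j; first by rewrite expn0; case: i; case: j.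
rewrite expnS => lt_i lt_j eq_ij.
have:= eq_ij 0 isT; rewrite /bit expn0 !divn1 => eq_odd.
rewrite -(odd_double_half i) -(odd_double_half j) eq_odd; congr (_ + _.*2)%N.
apply: IH => [||k lt_k]; rewrite ?ltn_half_double -?mul2n //.
by have:= eq_ij k.+1 lt_k; rewrite /bit expnS !divnMA !divn2.
Qed.

Lemma bits_inj : injective bits.
Proof.
move=> i j /rowP eq_ij; apply: val_inj.
apply: (bit_inj (ltn_ord i) (ltn_ord j)) => k lt_k.
by have:= eq_ij (Ordinal lt_k); rewrite !mxE.
Qed.

Lemma bits_bij : bijective bits.
Proof.
apply: inj_card_bij bits_inj _.
by rewrite card_mx card_bool card_ord mul1n.
Qed.

Lemma bits_surj x : exists i, bits i = x.
Proof. by have [g _ gK] := bits_bij; exists (g x). Qed.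

(* The operator |x> |-> c x |f x>. *)
Definition mono (f : V -> V) (c : V -> C) : 'M[C]_(2 ^ n) :=
  \matrix_(i, j) if bits i == f (bits j) then c (bits j) else 0.

Lemma eq_mono f g c d : f =1 g -> c =1 d -> mono f c = mono g d.
Proof. by move=> fg cd; apply/matrixP=> i j; rewrite !mxE fg cd. Qed.

Lemma mulmx_mono f c g d :
  mono f c *m mono g d = mono (f \o g) (fun x => c (g x) * d x).
Proof.
apply/matrixP=> i j; rewrite !mxE; have [l lE] := bits_surj (g (bits j)).
rewrite (bigD1 l) //= big1 => [|k /negbTE nkl].
  by rewrite !mxE lE eqxx addr0; case: eqP => _; rewrite ?mul0r.
by rewrite !mxE -lE (inj_eq bits_inj) nkl mulr0.
Qed.

Lemma mono_id : mono id (fun=> 1) = 1%:M.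
Proof. by apply/matrixP=> i j; rewrite !mxE (inj_eq bits_inj); case: eqP. Qed.

Lemma scale_mono a f c : a *: mono f c = mono f (fun x => a * c x).
Proof. by apply/matrixP=> i j; rewrite !mxE; case: eqP; rewrite ?mulr0. Qed.

Lemma adj_mono f g c : cancel f g -> cancel g f ->
  adj (mono f c) = mono g (fun x => (c (g x))^* ).
Proof.
move=> fK gK; apply/matrixP=> i j; rewrite !mxE -(can2_eq gK fK).
by rewrite eq_sym; case: eqP => [<-|]; rewrite ?rmorph0 // => ->.
Qed.

Lemma unitary_mono f g c : cancel f g -> cancel g f -> (forall x, `|c x| = 1) ->
  unitary (mono f c).
Proof.
move=> fK gK c1; rewrite /unitary (adj_mono _ fK gK) mulmx_mono -mono_id.
by apply: eq_mono => x /=; rewrite ?gK // -normCK c1 expr1n.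
Qed.

(** With no vanishing coefficient, the support of the matrix is the graph of [f]. *)
Lemma mono_inj f c g d : mono f c = mono g d -> (forall x, c x != 0) ->
  f =1 g /\ c =1 d.
Proof.
move=> /matrixP E c0; suff H x: f x = g x /\ c x = d x.
  by split=> x; case: (H x).
have [j jx] := bits_surj x; have [i ifx] := bits_surj (f x).
have := E i j; rewrite !mxE jx ifx eqxx; case: eqP => // _ cx0.
by have:= c0 x; rewrite cx0 eqxx.
Qed.

Lemma mxpowS (U : 'M[C]_(2 ^ n)) k : mxpow U k.+1 = U *m mxpow U k.
Proof. by []. Qed.

Lemma mxpowD (U : 'M[C]_(2 ^ n)) k l : mxpow U (k + l) = mxpow U k *m mxpow U l.
Proof. by elim: k => [|k IH]; rewrite ?mul1mx // addSn !mxpowS IH mulmxA. Qed.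

Lemma mxpow_mono f c k : mxpow (mono f c) k =
  mono (iter k f) (fun x => \prod_(j < k) c (iter j f x)).
Proof.
elim: k => [|k IH].
  by rewrite /mxpow /= -mono_id; apply: eq_mono => x //=; rewrite big_ord0.
rewrite mxpowS IH mulmx_mono; apply: eq_mono => x //=.
by rewrite big_ord_recr mulrC.
Qed.

(** This is X^a Z^b; the pair (a, b) is the symplectic label of a Pauli modulo phase. *)
Definition pauli (a b : V) := mono (fun x => x + a) (fun x => (-1) ^+ dot b x).

Lemma mulmx_pauli a b a' b' : pauli a b *m pauli a' b' =
  (-1) ^+ dot b a' *: pauli (a + a') (b + b').
Proof.
rewrite mulmx_mono scale_mono; apply: eq_mono => x /=.
  by rewrite (addrC a) addrA.
by rewrite dotDl dotDr !signr_addb mulrCA mulrA.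
Qed.

Lemma pauli_inj (c d : C) a b a' b' : c != 0 ->
  c *: pauli a b = d *: pauli a' b' -> [/\ c = d, a = a' & b = b'].
Proof.
move=> c0; rewrite !scale_mono => /mono_inj[x|fE cE].
  by rewrite mulf_neq0 ?signr_eq0.
have cd: c = d by have:= cE 0; rewrite !dot0r !mulr1.
split=> //; first by have:= fE 0; rewrite !add0r.
apply/dot_inj=> x; have:= cE x; rewrite -cd => /(mulfI c0).
by apply: signr_inj.
Qed.

(** Since Y = i X Z, every single-qubit Pauli is i^y X^x Z^z, where only Y contributes y = 1. *)
Lemma sigmaE (p : 'I_4) (b c : bool) : sigma C p b c =
  'i ^+ (val p == 2) * ((b == c (+) ((val p == 1) || (val p == 2)))%:R
     * (-1) ^+ (((val p == 2) || (val p == 3)) && c)).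
Proof.
by case: p b c => [[|[|[|[|//]]]] lt_p] [] []; rewrite /sigma /=
  !(expr0, expr1, mulr0n, mulr1n, mulr0, mul0r, mul1r, mulr1, mulrN1).
Qed.

Lemma sign_dot (a b : V) : (-1) ^+ dot a b = \prod_k (-1) ^+ (a 0 k && b 0 k) :> C.
Proof.
rewrite /dot mxE (big_morph (fun d : bool => (-1) ^+ d) (id1 := 1) (op1 := *%R)) //.
  by apply: eq_bigr => k _; rewrite mxE.
exact: signr_addb.
Qed.

Lemma pauli_stringE (p : {ffun 'I_n -> 'I_4}) : pauli_string C p =
  'i ^+ (\sum_k (val (p k) == 2)) *:
    pauli (\row_k ((val (p k) == 1) || (val (p k) == 2)))
          (\row_k ((val (p k) == 2) || (val (p k) == 3))).
Proof.
apply/matrixP=> i j; rewrite !mxE.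
rewrite (eq_bigr _ (fun k _ => sigmaE (p k) (bit i k) (bit j k))) !big_split /=.
rewrite expr_sum; congr (_ * _).
rewrite sign_dot; case: eqP => [/rowP ij|ij]; last first.
  have [/forallP ij'|/forallPn[k /negbTE nk]] :=
    boolP [forall k : 'I_n, bit i k == bit j k (+) ((val (p k) == 1) || (val (p k) == 2))].
    by case: ij; apply/rowP=> k; rewrite !mxE; apply/eqP.
  by rewrite (bigD1 k) //= nk !mul0r.
rewrite big1 ?mul1r => [|k _].
  by apply: eq_bigr => k _; rewrite !mxE.
by have := ij k; rewrite !mxE => ->; rewrite eqxx.
Qed.

Lemma iC4 : 'i ^+ 4 = 1 :> C.
Proof. by rewrite (exprM _ 2 2) sqrCi sqrrN expr1n. Qed.

Lemma isPauliP (M : 'M[C]_(2 ^ n)) :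
  isPauli M <-> exists (w : nat) (a b : V), M = 'i ^+ w *: pauli a b.
Proof.
split=> [[w [p ->]]|[w [a [b ->]]]].
  by rewrite pauli_stringE scalerA -exprD; eexists; eexists; eexists.
pose p : {ffun 'I_n -> 'I_4} := [ffun k =>
  inord (if a 0 k then if b 0 k then 2 else 1 else if b 0 k then 3 else 0)].
pose y := (\sum_k (val (p k) == 2))%N.
(* The string [p] brings its own factor i^y, one i for each Y; the extra exponent 3y cancels it, as
   i^(4y) = 1. *)
exists (inord ((w + 3 * y) %% 4)), p.
rewrite pauli_stringE scalerA inordK ?ltn_pmod // (expr_mod _ iC4) -exprD -/y.
have -> : (w + 3 * y + y = w + 4 * y)%N by rewrite -addnA -mulSnr.
rewrite exprD exprM iC4 expr1n mulr1; congr (_ *: pauli _ _);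
  by apply/rowP=> k; rewrite mxE ffunE; case: (a 0 k) (b 0 k) => [] []; rewrite /= inordK.
Qed.

Lemma projPauliP (M : 'M[C]_(2 ^ n)) :
  projPauli M <-> exists (c : C) (a b : V), `|c| = 1 /\ M = c *: pauli a b.
Proof.
split=> [[c [P [c1 [/isPauliP[w [a [b ->]]] ->]]]]|[c [a [b [c1 ->]]]]].
  exists (c * 'i ^+ w), a, b; rewrite scalerA normrM normrX normCi expr1n c1 mulr1.
  by [].
exists c, (pauli a b); split=> //; split=> //; apply/isPauliP.
by exists 0%N, a, b; rewrite scale1r.
Qed.

Lemma isPauli_projPauli (M : 'M[C]_(2 ^ n)) : isPauli M -> projPauli M.
Proof. by move=> PM; exists 1, M; rewrite normr1 scale1r. Qed.

Lemma projPauliM (M N : 'M[C]_(2 ^ n)) :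
  projPauli M -> projPauli N -> projPauli (M *m N).
Proof.
move=> /projPauliP[c [a [b [c1 ->]]]] /projPauliP[d [a' [b' [d1 ->]]]].
apply/projPauliP; exists (c * (d * (-1) ^+ dot b a')), (a + a'), (b + b').
rewrite !normrM c1 d1 normrX normrN1 expr1n !mulr1 -scalemxAl -scalemxAr.
by rewrite mulmx_pauli !scalerA !mulrA.
Qed.

(** Projective Paulis are closed under squaring. Hence failure at one exponent excludes all smaller
    ones. *)
Lemma projPauli_exp2n (M : 'M[C]_(2 ^ n)) t s : (t <= s)%N ->
  projPauli (mxpow M (2 ^ t)) -> projPauli (mxpow M (2 ^ s)).
Proof.
move=> /subnKC <-; elim: (s - t)%N => [|k IH] PM; first by rewrite addn0.
by rewrite addnS expnS mul2n -addnn mxpowD; apply: projPauliM; apply: IH.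
Qed.

Lemma unitaryC (U : 'M[C]_(2 ^ n)) : unitary U -> adj U *m U = 1%:M.
Proof. exact: mulmx1C. Qed.

Lemma unitary_mulIm (U M N : 'M[C]_(2 ^ n)) : unitary U -> M *m U = N *m U -> M = N.
Proof.
by move=> uU /(congr1 (mulmx^~ (adj U))); rewrite -!mulmxA uU !mulmx1.
Qed.

Lemma unitaryM (U W : 'M[C]_(2 ^ n)) : unitary U -> unitary W -> unitary (U *m W).
Proof.
rewrite /unitary => uU uW.
have -> : adj (U *m W) = adj W *m adj U by rewrite /adj map_mxM trmx_mul.
by rewrite mulmxA -(mulmxA U) uW mulmx1.
Qed.

Lemma unitary_mxpow (U : 'M[C]_(2 ^ n)) k : unitary U -> unitary (mxpow U k).
Proof.
move=> uU; elim: k => [|k IH]; last exact: unitaryM.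
by rewrite /unitary /adj map_mx1 trmx1 mulmx1.
Qed.

Lemma unitary_monoP f g c : cancel f g -> cancel g f -> unitary (mono f c) ->
  forall x, `|c x| = 1.
Proof.
move=> fK gK; rewrite /unitary (adj_mono _ fK gK) mulmx_mono -mono_id => /esym.
case/mono_inj => [x|_ E x]; first exact: oner_neq0.
by apply/eqP; have := E (f x); rewrite /= fK -normCK => /esym/eqP; rewrite sqrp_eq1.
Qed.

Lemma pauli_diag b :
  pauli 0 b = diag_mx (\row_i (-1) ^+ dot b (bits i)) :> 'M[C]_(2 ^ n).
Proof.
apply/matrixP=> i j; rewrite !mxE addr0 (inj_eq (@bits_inj)).
by case: eqP => [->|].
Qed.

(* An irreducibility (Schur) argument: commutation with the Z strings forces M to be
   a translation up to a diagonal factor v, commutation with the X strings forces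
   v / v 0 to be a character. *)
Lemma commute_pauli_projPauli (M : 'M[C]_(2 ^ n)) : unitary M ->
  (forall a b, exists w : C, M *m pauli a b = w *: (pauli a b *m M)) -> projPauli M.
Proof.
move=> uM comM.
have [[i0 j0] /= M0]: exists ij : I2n * I2n, M ij.1 ij.2 != 0.
  apply/existsP; apply: contraT => /existsPn M0.
  have ME: M = 0 by apply/matrixP=> i j; rewrite mxE; apply/eqP/negPn/(M0 (i, j)).
  have [i _] := bits_surj (0 : V); have /matrixP/(_ i i)/eqP := uM.
  by rewrite ME mul0mx !mxE eqxx eq_sym oner_eq0.
pose a := bits i0 + bits j0.
have shift i j : M i j != 0 -> bits i = bits j + a.
  move=> Mij; suff <-: bits i + bits j = a by rewrite (addrC (bits i)) addrA addvv add0r.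
  apply: dot_injr => b; have [w wE] := comM 0 b.
  (* Commutation with Z^b, read at a nonzero entry (k, l), gives a sign that is the same for all
     nonzero entries. *)
  suff sgn k l : M k l != 0 -> (-1) ^+ dot b (bits k + bits l) = w.
    by apply: (@signr_inj C); rewrite !sgn.
  move=> Mkl; have /matrixP/(_ k l) := wE; rewrite pauli_diag mul_mx_diag mul_diag_mx !mxE.
  rewrite mulrA (mulrC (M k l)) => /(mulIf Mkl) E.
  by rewrite dotDr signr_addb E mulrCA -expr2 sqrr_sign mulr1.
have [unb bitsK unbK] := bits_bij.
pose v x := M (unb (x + a)) (unb x).
have ME: M = mono (fun x => x + a) v.
  apply/matrixP=> i j; rewrite mxE /v bitsK; case: eqP => [<-|ne]; first by rewrite bitsK.
  by apply/eqP/idPn=> /shift.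
have v1: forall x, `|v x| = 1.
  by apply: (unitary_monoP (addv_can a) (addv_can a)); rewrite -ME.
have v0 x : v x != 0 by rewrite -normr_gt0 v1.
(* Commutation with X^d makes v (x + d) a constant multiple of v x; x = 0 identifies the
   constant. *)
have vD x d : v (x + d) = v d / v 0 * v x.
  have [w] := comM d 0; rewrite ME !mulmx_mono scale_mono.
  case/mono_inj=> [y|_ E]; first by rewrite mulf_neq0 ?signr_eq0.
  have {}E y : v (y + d) = w * v y by have := E y; rewrite /= !dot0l !mulr1 mul1r.
  by rewrite E -(add0r d) E mulfK.
pose g x := v x != v 0.
(* Taking d = x, where x + x = 0, shows that the ratio squares to 1. *)
have gE x : v x / v 0 = (-1) ^+ g x.
  have := vD x x; rewrite addvv => E.
  have /eqP: (v x / v 0) ^+ 2 = 1 by rewrite expr2 mulrA -E divff.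
  rewrite sqrf_eq1 /g => /orP[]/eqP F; rewrite F -(mulfVK (v0 0) (v x)) F.
    by rewrite mul1r eqxx.
  by rewrite mulN1r eqNr (negbTE (v0 0)).
have [x y|b bE] := @additive_dotE n g.
  apply: (@signr_inj C); rewrite signr_addb -!gE vD mulrAC mulrC mulrCA.
  by rewrite mulrC mulrA.
apply/projPauliP; exists (v 0), a, b; split=> //.
rewrite ME scale_mono; apply: eq_mono => // x.
by rewrite -bE -gE mulrC mulfVK.
Qed.

End Monomial.

(** * The symplectic action of a Clifford unitary *)

Section UpperBound.
Variables (C : numClosedFieldType) (n : nat).
Notation V2 := 'rV[bool]_(n + n).

Definition vpauli (v : V2) : 'M[C]_(2 ^ n) := pauli C (lsubmx v) (rsubmx v).

Lemma mulmx_vpauli u v : exists2 s : C, s != 0 & vpauli u *m vpauli v = s *: vpauli (u + v).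
Proof.
exists ((-1) ^+ dot (rsubmx u) (lsubmx v)); first by rewrite signr_eq0.
by rewrite /vpauli mulmx_pauli !linearD.
Qed.

Lemma vpauli_inj (c d : C) u v : c != 0 -> c *: vpauli u = d *: vpauli v -> u = v.
Proof.
move=> c0 /(pauli_inj c0)[_ l r].
by rewrite -(hsubmxK u) -(hsubmxK v) l r.
Qed.

(** The map [f] is conjugation by [U] on Pauli labels; the commutation form lets powers of [U]
    compose without adjoints. *)
Definition intertwines (U : 'M[C]_(2 ^ n)) (f : V2 -> V2) :=
  forall v, exists2 w : C, w != 0 & U *m vpauli v = w *: vpauli (f v) *m U.

Lemma clifford_intertwines U : clifford U -> exists f, intertwines U f.
Proof.
case=> uU PU; have: forall v, exists u, exists2 w : C, w != 0 &
  U *m vpauli v = w *: vpauli u *m U; last first.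
  by move=> /fin_all_exists.
move=> v.
have /PU/isPauliP[w [a [b E]]] : isPauli (vpauli v).
  by apply/isPauliP; exists 0%N, (lsubmx v), (rsubmx v); rewrite scale1r.
exists (row_mx a b); exists ('i ^+ w); first by rewrite expf_neq0 ?neq0Ci.
by rewrite /vpauli row_mxKl row_mxKr -E -mulmxA unitaryC ?mulmx1.
Qed.

Lemma intertwines_mxpow U f k : intertwines U f -> intertwines (mxpow U k) (iter k f).
Proof.
move=> Uf; elim: k => [|k IH] v.
  by exists 1; rewrite ?oner_neq0 // scale1r mulmx1 mul1mx.
have [w w0 E] := IH v; have [w' w'0 E'] := Uf (iter k f v).
exists (w * w'); first exact: mulf_neq0.
rewrite mxpowS -mulmxA E -scalemxAl -scalemxAr (mulmxA U) E' -!scalemxAl scalerA.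
by rewrite -mulmxA.
Qed.

(** [U] is moved past a product of two Paulis, once as a whole and once factor by factor;
    proportional Paulis have equal labels. *)
Lemma intertwinesD U f : unitary U -> intertwines U f -> {morph f : x y / x + y}.
Proof.
move=> uU Uf x y.
have [s s0 sE] := mulmx_vpauli x y; have [r r0 rE] := mulmx_vpauli (f x) (f y).
have [w w0 wE] := Uf x; have [w' w'0 w'E] := Uf y; have [z z0 zE] := Uf (x + y).
apply: (@vpauli_inj (s * z) (w * w' * r)); first exact: mulf_neq0.
apply: (unitary_mulIm uU).
have -> : (s * z) *: vpauli (f (x + y)) *m U = U *m vpauli x *m vpauli y.
  by rewrite -scalerA -scalemxAl -zE scalemxAr -sE mulmxA.
rewrite wE -mulmxA w'E mulmxA -scalemxAr -!scalemxAl rE -!scalemxAl !scalerA.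
by rewrite (mulrC w').
Qed.

Lemma projPauli_intertwines U f : projPauli U -> intertwines U f -> f =1 id.
Proof.
move=> /projPauliP[c [a [b [c1 ->]]]] Uf v; have [w w0 E] := Uf v.
have c0: c != 0 by rewrite -normr_gt0 c1.
(* The two sides of the intertwining relation are Paulis labelled (a, b) + v and f v + (a, b). *)
have -> : f v = row_mx a b + v + row_mx a b.
  have aE: pauli C a b = vpauli (row_mx a b) by rewrite /vpauli row_mxKl row_mxKr.
  have [s s0 sE] := mulmx_vpauli (row_mx a b) v.
  have [r r0 rE] := mulmx_vpauli (f v) (row_mx a b).
  rewrite (@vpauli_inj (c * s) (c * w * r) (row_mx a b + v) (f v + row_mx a b)).
  - by rewrite addvK.
  - exact: mulf_neq0.
  by move: E; rewrite aE -scalemxAl sE -scalemxAr -scalemxAl rE !scalerA => ->.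
by rewrite addrAC addvv add0r.
Qed.

Lemma intertwines_id_projPauli U : unitary U -> intertwines U id -> projPauli U.
Proof.
move=> uU Uid; apply: commute_pauli_projPauli => // a b.
have [w _] := Uid (row_mx a b); rewrite /vpauli row_mxKl row_mxKr => ->.
by exists w; rewrite scalemxAl.
Qed.

End UpperBound.

Lemma clifford_mxpow_projPauli (C : numClosedFieldType) n (U : 'M[C]_(2 ^ n)) t s :
  (0 < n)%N -> clifford U -> projPauli (mxpow U (2 ^ t)) -> (2 * n <= 2 ^ s)%N ->
  projPauli (mxpow U (2 ^ s)).
Proof.
case: n U => // p U _ cU PUt le_s; have uU := cU.1.
have [f Uf] := clifford_intertwines cU.
have [S fS] := additive_mulmx (intertwinesD uU Uf).
(* The dimension is displayed as a successor to give the matrices their ring structure. *)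
pose S' : 'M[bool]_((p + p.+1).+1) := S.
have iterS k v : iter k f v = v *m (S' ^+ k).
  elim: k => [|k IH]; first by rewrite mulmx1.
  by rewrite /= IH fS exprSr mulmxA.
have St: S' ^+ (2 ^ t) = 1.
  apply/row_matrixP=> i; rewrite !rowE -iterS mulmx1.
  exact: (projPauli_intertwines PUt (intertwines_mxpow _ Uf)).
apply: intertwines_id_projPauli; first exact: unitary_mxpow.
move=> v; have := intertwines_mxpow (2 ^ s) Uf v.
by rewrite iterS (unipotent_exp2n St) ?mulmx1 // -addSn addnn -mul2n.
Qed.

(* Lucas: (1 + X)^(2^r) = 1 + X^(2^r) over F_2. *)
Lemma odd_bin_exp2n r j i : odd 'C(j + 2 ^ r, i) =
  odd 'C(j, i) (+) ((2 ^ r <= i)%N && odd 'C(j, i - 2 ^ r)).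
Proof.
elim: r j i => [|r IH] j i.
  by case: i => [|i]; rewrite addn1 ?bin0 // binS oddD subn1 addbC.
rewrite expnS mul2n -addnn addnA !IH; case: leqP => [le_i|lt_i] /=.
  rewrite leq_subRL // subnDA; case: odd; case: odd; case: (_ && _) => //.
by rewrite leqNgt (leq_trans lt_i) ?leq_addr //= !addbF.
Qed.

(** * A Clifford unitary of maximal periodicity *)

Section Witness.
Variables (C : numClosedFieldType) (p s : nat).
Notation n := p.+1.
Notation V := 'rV[bool]_n.
Hypothesis le_ns : (n <= 2 ^ s)%N.

(* The j-th power of the lower unitriangular Jordan block of size n. *)
Definition binmx j : 'M[bool]_n := \matrix_(i, k) ((k <= i)%N && odd 'C(j, i - k)).

(** Row i of [binmx 1] has ones only in columns i and i - 1, so multiplying by it is Pascal's rule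
    mod 2. *)
Lemma binmxE j : binmx 1 ^+ j = binmx j.
Proof.
elim: j => [|j IH].
  apply/matrixP=> i k; rewrite !mxE bin0n -val_eqE /=.
  by case: ltngtP => [lt_ki|//|->]; rewrite ?subnn // subn_eq0 leqNgt lt_ki.
rewrite exprS IH; apply/matrixP=> i k; rewrite !mxE (bigD1 i) //= !mxE.
rewrite leqnn subnn mul1r.
have -> : (k <= i)%N && odd 'C(j.+1, i - k) =
    ((k <= i)%N && odd 'C(j, i - k)) (+) ((k < i)%N && odd 'C(j, i.-1 - k)).
  case: ltngtP => //= [lt_ki|->]; last by rewrite subnn !bin0.
  have -> : (i - k = (i.-1 - k).+1)%N by lia.
  by rewrite binS oddD.
(* For i = 0 the predecessor defaults to 0, but the guard k < i fails and the term vanishes. *)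
congr (_ + _); case: (posnP i) => [i0|i_gt0].
  rewrite i0 ltn0 big1 // => l /negbTE nli; rewrite !mxE.
  have -> // : (l <= i)%N = false by move: nli; rewrite -val_eqE /= i0; lia.
have lt_i: (i.-1 < n)%N by rewrite (leq_ltn_trans (leq_pred _)).
rewrite (bigD1 (Ordinal lt_i)) /=; last by rewrite -val_eqE /= neq_ltn ltn_predL i_gt0.
rewrite !mxE /= leq_pred (_ : i - i.-1 = 1)%N; last by lia.
rewrite (_ : (k <= i.-1) = (k < i))%N; last by lia.
rewrite mul1r big1 ?addr0 //.
move=> l /andP[nli nlp]; rewrite !mxE; case: leqP => //= le_li.
have lt: (1 < i - l)%N.
  move: nli nlp; rewrite -!val_eqE /=; lia.
by rewrite bin_small // mul0r.
Qed.

(** The binomials C(2^s, d) with 0 < d < 2^s are even, and i - k stays below n, which is at most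
    2^s. *)
Lemma binmx1 : binmx 1 ^+ (2 ^ s) = 1.
Proof.
rewrite binmxE; apply/matrixP=> i k; rewrite !mxE.
rewrite -[(2 ^ s)%N]add0n odd_bin_exp2n bin0n -val_eqE /=.
rewrite [(2 ^ s <= _)%N]leqNgt.
rewrite (leq_ltn_trans (leq_subr _ _) (leq_trans (ltn_ord i) le_ns)) addbF.
by case: ltngtP => [lt_ki|//|->]; rewrite ?subnn // subn_eq0 leqNgt lt_ki.
Qed.

Notation G := (binmx 1).

Definition witness : 'M[C]_(2 ^ n) := mono (fun x => x *m G) (fun x => 'i ^+ x 0 0).

Lemma binmx_unit : G \in unitmx.
Proof.
have := binmx1; rewrite -(prednK (expn_gt0 2 s)) exprS => GG.
by case: (mulmx1_unit GG).
Qed.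

Lemma witness_clifford : clifford witness.
Proof.
have uG := binmx_unit; have uW: unitary witness.
  apply: unitary_mono (mulmxK uG) (mulmxKV uG) _ => x.
  by rewrite normrX normCi expr1n.
split=> // P /isPauliP[w [a [b ->]]]; apply/isPauliP.
(* The phase gate sends X to i X Z on qubit 0, adding a factor i and a Z when a_0 = 1; the circuit
   then acts by G on X labels and by its inverse transpose on Z labels. *)
exists (a 0%R 0%R + w)%N, (a *m G).
exists ((b + (if a 0 0 then delta_mx 0 0 else 0)) *m (invmx G)^T).
rewrite -scalemxAr exprD mulrC -scalerA; rewrite -scalemxAl; congr (_ *: _).
suff -> : witness *m pauli C a b = 'i ^+ a 0 0 *: pauli C (a *m G)
    ((b + (if a 0 0 then delta_mx 0 0 else 0)) *m (invmx G)^T) *m witness.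
  by rewrite -mulmxA uW mulmx1.
rewrite scale_mono !mulmx_mono; apply: eq_mono => x /=; first by rewrite mulmxDl.
rewrite -dotMr mulmxK // dotDl signr_addb mxE.
case: (a 0 0); rewrite ?dot_deltal ?dot0l /GRing.add /=; case: (x 0 0);
  rewrite !(expr0, expr1, mul1r, mulr1, addbT, addbF) //=.
  by rewrite mulrN1 mulrN mulNr mulrAC -expr2 sqrCi mulN1r opprK.
by rewrite mulrC.
Qed.

Definition phase (x : V) : C := \prod_(j < 2 ^ s) 'i ^+ (x *m G ^+ j) 0 0.

Lemma witness_exp2n : mxpow witness (2 ^ s) = mono id phase.
Proof.
have iterG j x : iter j (fun y : V => y *m G) x = x *m G ^+ j.
  elim: j => [|j IH]; first by rewrite mulmx1.
  by rewrite /= IH exprSr mulmxA.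
rewrite mxpow_mono; apply: eq_mono => x; first by rewrite iterG binmx1 ?mulmx1.
by apply: eq_bigr => j _; rewrite iterG.
Qed.

(** For bits u and v, i^(u xor v) = i^u i^v (-1)^(uv): the sign corrects the carry. *)
Lemma phaseD x y : phase (x + y) =
  phase x * phase y * \prod_(j < 2 ^ s) (-1) ^+ ((x *m G ^+ j) 0 0 && (y *m G ^+ j) 0 0).
Proof.
rewrite /phase -!big_split; apply: eq_bigr => j _ /=; rewrite mulmxDl mxE.
case: (_ 0 0) (_ 0 0) => [] []; rewrite /GRing.add /= !(expr0, expr1, mul1r, mulr1) //.
by rewrite -expr2 sqrCi mulrN1 opprK.
Qed.

(** By Lucas, the first parity tests the top bit of j and the second asks that all r lower bits be
    1. *)
Lemma odd_bin_pair h r j : h = (2 ^ r)%N -> (j < h + h)%N ->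
  odd 'C(j, h) && odd 'C(j, h.-1) = (j == (h + h).-1).
Proof.
move=> hE lt_j; have h0: (0 < h)%N by rewrite hE expn_gt0.
have [lt_jh|le_hj] := ltnP j h; first by rewrite bin_small //=; lia.
rewrite -(subnK le_hj); set i := (j - h)%N; have lt_i: (i < h)%N by lia.
rewrite {1 3}hE !odd_bin_exp2n -hE leqnn subnn bin0 bin_small //=.
rewrite (_ : h <= h.-1 = false)%N /=; last by lia.
rewrite addbF; have [->|ne] := eqVneq i h.-1; first by rewrite binn; lia.
by rewrite bin_small /=; lia.
Qed.

Lemma witness_not_projPauli : (0 < s)%N -> (2 ^ s.-1 < n)%N ->
  ~ projPauli (mxpow witness (2 ^ s)).
Proof.
move=> s0 lt_hn; set h := (2 ^ s.-1)%N in lt_hn *.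
have h2: (2 ^ s = h + h)%N by rewrite -(prednK s0) expnS mul2n addnn.
have h0: (0 < h)%N by rewrite expn_gt0.
have phase0 x : phase x != 0.
  by apply/prodf_neq0 => j _; rewrite expf_neq0 ?neq0Ci.
rewrite witness_exp2n => /projPauliP[c [a [b [_]]]].
rewrite scale_mono => /mono_inj[//|_ E].
have c1: c = 1.
  have := E 0; rewrite dot0r mulr1 /phase big1 // => j _.
  by rewrite mul0mx mxE.
(* The cross term of phaseD at e_h, e_(h-1) has the single factor -1, at j = 2h - 1. *)
pose e i : V := delta_mx 0 (inord i).
have eE i j : (i < n)%N -> (e i *m G ^+ j) 0 0 = odd 'C(j, i).
  by move=> lt_i; rewrite -rowE binmxE !mxE inordK ?subn0.
(* A diagonal Pauli with c = 1 is a character of F_2^n, hence multiplicative. *)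
have pD x y : phase (x + y) = phase x * phase y.
  by rewrite !E c1 !mul1r dotDr signr_addb.
have lt_hn': (h.-1 < n)%N by lia.
have lt_j: ((h + h).-1 < 2 ^ s)%N by lia.
have /eqP := phaseD (e h) (e h.-1).
rewrite pD -subr_eq0 -{1}[_ * phase _]mulr1 -mulrBr !mulf_eq0 !(negbTE (phase0 _)) /=.
rewrite (bigD1 (Ordinal lt_j)) //= big1 => [|j ne_j].
  rewrite !eE // (odd_bin_pair (erefl h)) ?eqxx /=; last by lia.
  by rewrite expr1 mulr1 opprK -mulr2n pnatr_eq0.
rewrite !eE // (odd_bin_pair (erefl h)); last by rewrite -h2.
by move: ne_j; rewrite -val_eqE /= => /negbTE ->.
Qed.

Lemma witness_pauli : isPauli (mxpow witness (2 ^ s.+1)).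
Proof.
(* This sum lives in F_2, so it is Q mod 2; squaring turns i^Q into (-1)^Q, which depends on nothing
   else. *)
have [x y|b bE] := @additive_dotE n (fun x => \sum_(j < 2 ^ s) (x *m G ^+ j) 0 0).
  rewrite -[_ (+) _]/(_ + _) -big_split; apply: eq_bigr => j _.
  by rewrite mulmxDl mxE.
apply/isPauliP; exists 0%N, 0, b; rewrite scale1r.
have -> : (2 ^ s.+1 = 2 ^ s + 2 ^ s)%N by rewrite expnS mul2n addnn.
rewrite mxpowD.
rewrite witness_exp2n mulmx_mono; apply: eq_mono => x /=; first by rewrite addr0.
rewrite -bE (big_morph (fun d : bool => (-1) ^+ d) (id1 := 1) (op1 := *%R)) //.
  rewrite -big_split; apply: eq_bigr => j _ /=.
  by case: (_ 0 0); rewrite ?expr0 ?mulr1 // -expr2 sqrCi.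
exact: signr_addb.
Qed.

End Witness.

(* up_log 2 (2 * n) = ceil(log_2(2n)) *)
Theorem mainTheorem7 (C : numClosedFieldType) :
  (forall (n : nat) (U : 'M[C]_(2 ^ n)),
      (1 <= n)%N -> clifford U ->
      (exists t : nat, projPauli (mxpow U (2 ^ t))) ->
      forall m : nat, proj_pauli_periodicity U m -> (m <= up_log 2 (2 * n))%N)
  /\
  (forall n : nat, (1 < n)%N ->
      exists U : 'M[C]_(2 ^ n),
        clifford U /\
        proj_pauli_periodicity U (up_log 2 (2 * n)) /\
        pauli_periodicity U (up_log 2 (2 * n))).
Proof.
split=> [n U n_gt0 cU [t PUt] m [_ min_m]|[//|p] n_gt1].
  rewrite leqNgt; apply/negP=> /min_m; apply.
  by apply: clifford_mxpow_projPauli PUt _ => //; apply: up_logP.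
(* The claimed periodicity is s + 1, since doubling n raises the logarithm by one. *)
pose s := up_log 2 p.+1; have le_ns: (p.+1 <= 2 ^ s)%N by apply: up_logP.
have not_proj t : (t < s.+1)%N -> ~ projPauli (mxpow (witness C p) (2 ^ t)).
  rewrite ltnS => le_ts /(projPauli_exp2n le_ts); apply: witness_not_projPauli => //.
    by rewrite up_log_gt0.
  exact: up_log_gtn.
exists (witness C p); rewrite up_logMp // -/s.
have PW := witness_pauli C le_ns; split; first exact: witness_clifford le_ns.
split; split=> //; first exact: isPauli_projPauli.
by move=> t /not_proj nP /isPauli_projPauli.
Qed.
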